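(* Let $F$ be a field, let $V$ be a four-dimensional vector space over $F$, let $C$ be a plane of $\mathbb{P}(V\wedge V)$ that has no point in common with the Klein quadric $\mathcal{Q}$, and let $C^\perp$ be the polar plane of $C$ with respect to the Klein quadric $\mathcal{Q}$. Then the following assertions hold: (a) The plane $C^\perp$ has no point in common with $\mathcal{Q}$. (b) If $\operatorname{Char} F\neq 2$ then the planes $C$ and $C^\perp$ have no point in common. (c) If $\operatorname{Char} F=2$ then either $C\cap C^\perp$ is a single point or $C=C^\perp$.
   Context: Fields are commutative. For a vector space $U$ over $F$, $\mathbb{P}(U)$ is the projective space of all subspaces of $U$; points, lines, planes are the subspaces of vector dimension $1,2,3$. The Klein quadric $\mathcal{Q}$ is the set of all points $F(u\wedge v)$ of $\mathbb{P}(V\wedge V)$ with $u,v\in V$ linearly independent. The polarity $\perp$ of the Klein quadric sends a subspace $X\subset V\wedge V$ to $X^\perp=\{y\in V\wedge V\mid x\wedge y=0\text{ in }\bigwedge^4V\text{ for all }x\in X\}$. *)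

(* Defs.v *)
From HB Require Import structures.
From mathcomp Require Import all_boot all_order all_algebra all_field.

Set Implicit Arguments.
Unset Strict Implicit.
Unset Printing Implicit Defensive.

Import GRing.Theory.
Local Open Scope ring_scope.

Section Exterior.

Variables (F : fieldType) (V : vectType F) (A : falgType F).
Variable iota : 'Hom(V, A).

(* (A, iota) is the exterior algebra of V, by its universal property among all
   associative unital F-algebras.  As V is finite dimensional, so is its
   exterior algebra, hence falgType for A is no restriction.  The product of A
   is the wedge product. *)
Definition exterior_algebra : Prop :=
  (forall v : V, iota v * iota v = 0) /\
  forall (B : algType F) (f : {linear V -> B}), (forall v, f v * f v = 0) ->
    (exists g : {lrmorphism A -> B}, forall v, g (iota v) = f v) /\
    (forall g h : {lrmorphism A -> B},
       (forall v, g (iota v) = f v) -> (forall v, h (iota v) = f v) -> g =1 h).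

(* V /\ V, the degree 2 component of A, spanned by all u /\ v. *)
Definition wedge2 : {vspace A} := (limg iota * limg iota)%VS.

Definition is_point (P : {vspace A}) : Prop := (P <= wedge2)%VS /\ \dim P = 1%N.

Definition is_plane (C : {vspace A}) : Prop := (C <= wedge2)%VS /\ \dim C = 3%N.

Definition klein_quadric (P : {vspace A}) : Prop :=
  exists u v : V, free [:: u; v] /\ P = <[iota u * iota v]>%VS.

Definition disjoint_from_quadric (C : {vspace A}) : Prop :=
  forall P, is_point P -> (P <= C)%VS -> ~ klein_quadric P.

Definition no_common_point (C D : {vspace A}) : Prop :=
  forall P, is_point P -> ~ ((P <= C)%VS /\ (P <= D)%VS).

(* For x, y in V /\ V the product x * y lies in the degree 4 component of A,
   so x /\ y = 0 in the fourth exterior power iff x * y = 0 in A. The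
   definition ranges over a basis of X; polarP is the usual description. *)
Definition polar (X : {vspace A}) : {vspace A} :=
  (wedge2 :&: \bigcap_(x <- vbasis X) lker (amull x))%VS.

Lemma polarP (X : {vspace A}) (y : A) :
  reflect (y \in wedge2 /\ forall x, x \in X -> x * y = 0) (y \in polar X).
Proof.
have bigcapP (s : seq A) : (y \in (\bigcap_(x <- s) lker (amull x))%VS) =
    all (fun x => x * y == 0) s.
  elim: s => [|x s IHs]; first by rewrite big_nil memvf.
  by rewrite big_cons memv_cap IHs memv_ker lfunE.
rewrite memv_cap bigcapP; apply: (iffP andP) => -[yW yX]; split=> //.
  move=> x /coord_vbasis->; rewrite mulr_suml big1 // => i _.
  rewrite -scalerAl (eqP (allP yX _ _)) ?scaler0 //.
  by rewrite mem_nth ?size_tuple.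
by apply/allP => x /vbasis_mem xX; rewrite yX.
Qed.

End Exterior.

(* Main.v *)
Require Import Defs.
From HB Require Import structures.
From mathcomp Require Import all_boot all_order all_algebra all_field.
From mathcomp Require Import ring zify.

Set Implicit Arguments.
Unset Strict Implicit.
Unset Printing Implicit Defensive.

Import GRing.Theory.
Local Open Scope ring_scope.

(** Multiplication restricts to a symmetric bilinear form on [wedge2 iota],
    with values in the line spanned by the product of the four vectors of a
    basis of [V]. In Pluecker coordinates it is the polar form of the
    quadratic form [p01 p23 - p02 p13 + p03 p12], whose zeros are the
    decomposable bivectors [u /\ v]. The form is nondegenerate on a space of
    dimension 6 ([wedge2_nondegenerate], [dim_wedge2]), so
    [\dim (polar X) + \dim X = 6] ([dim_polar]) and the polar of a plane is a
    plane.

    Assertion (a), in any characteristic ([polar_disjoint]): suppose that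
    [s = u /\ v] is a point of the quadric in the polar of [C]. All [u /\ w]
    with [w] in [V] form a plane of the quadric through [s], hence inside the
    polar hyperplane of [s]. That hyperplane has dimension 5 and contains [C]
    too, so the two planes meet, and a common point is a point of the quadric
    on [C].

    Assertion (b) ([no_common_point_polar]): a common point [x] of [C] and its
    polar satisfies [x * x = 0], and [x * x] is twice the quadratic form. If 2
    is invertible, [x] is therefore decomposable, which [C] forbids.

    Assertion (c) ([cap_polar_alternating]): in characteristic 2 the form is
    alternating, so its restriction to the three-dimensional [C] has rank 0
    or 2, and its radical, which is the intersection of [C] with its polar, has
    dimension 3 or 1.

    All this rests on the product of a basis of [V] being nonzero
    ([wedge4_neq0]). The universal property only yields this once some algebra
    is exhibited where four square-zero images of basis vectors have a nonzero
    product: here, matrices of creation operators. *)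

(** * A matrix model in which a product of basis vectors is nonzero *)

(** This is [2 ^ n], unfolded so that a matrix of the next size is literally a
    two by two block matrix. *)
Fixpoint fock_dim n :=
  if n is n'.+1 then (fock_dim n' + fock_dim n')%N else 1%N.

Section CreationOperators.

Variables (F : fieldType) (V : vectType F) (phi : nat -> {scalar V}).

(** Left multiplication by [v] on the exterior algebra of an [n]-dimensional
    space in which [v] has coordinates [phi 0 v, ..., phi n.-1 v]. The blocks
    come from splitting that algebra according to whether the last basis vector
    occurs; moving past that vector produces the sign. *)
Fixpoint creation n (v : V) : 'M[F]_(fock_dim n) :=
  if n is n'.+1 return 'M[F]_(fock_dim n)
  then block_mx (- creation n' v) 0 (phi n' v)%:M (creation n' v)
  else 0.

Lemma creation_is_linear n : linear (creation n).
Proof.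
elim: n => [|n IHn] a u v /=; first by rewrite scaler0 addr0.
rewrite IHn linearP scale_block_mx add_block_mx opprD scalerN scaler0 addr0.
by rewrite scale_scalar_mx raddfD.
Qed.

HB.instance Definition _ n :=
  GRing.isLinear.Build F V 'M[F]_(fock_dim n) *:%R (creation n)
    (creation_is_linear n).

Lemma creation_sq n v : creation n v *m creation n v = 0.
Proof.
elim: n => [|n IHn] /=; first by rewrite mul0mx.
rewrite mulmx_block !mul0mx !mulmx0 mulNmx mulmxN opprK IHn !addr0.
by rewrite mulmxN scalar_mxC addNr block_mx0.
Qed.

Variables (m : nat) (e : nat -> V).
Hypothesis phi_e :
  forall i j, (i < m)%N -> (j < m)%N -> phi i (e j) = (i == j)%:R.

Lemma creation_out n k : (n <= k < m)%N -> creation n (e k) = 0.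
Proof.
elim: n => [//|n IHn] /andP[ltnk ltk] /=.
rewrite IHn ?(ltnW ltnk)// phi_e ?(ltn_trans ltnk)// ltn_eqF// oppr0 raddf0.
by rewrite block_mx0.
Qed.

(** In size [n.+1] the first [n] factors are block diagonal, while the last one
    is the identity in the lower left corner; the lower left corner of the
    product is therefore the product in size [n]. *)
Lemma creation_top n : (n <= m)%N -> \prod_(k < n) creation n (e k) != 0.
Proof.
elim: n => [|n IHn] ltn; first by rewrite big_ord0 (oner_neq0 'M[F]_1).
have diag (s : seq 'I_n) : \prod_(k <- s) creation n.+1 (e k) =
    block_mx (\prod_(k <- s) - creation n (e k)) 0 0
             (\prod_(k <- s) creation n (e k)).
  elim: s => [|k s IHs]; first by rewrite !big_nil -scalar_mx_block.
  rewrite !big_cons IHs -mulmxE /= phi_e ?(ltn_trans (ltn_ord k))//.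
  by rewrite gtn_eqF ?ltn_ord// raddf0 mulmx_block !mulmx0 !mul0mx !addr0 add0r.
rewrite big_ord_recr /= (diag (index_enum _)) creation_out ?leqnn//.
rewrite phi_e// eqxx oppr0 -mulmxE mulmx_block.
rewrite !mulmx0 !mul0mx mulmx1 !addr0 add0r.
apply: contraNneq (IHn (ltnW ltn)) => prod0.
rewrite -(block_mxKdl (0 : 'M_(fock_dim n)) (0 : 'M_(fock_dim n))
  (\prod_(k < n) creation n (e k)) 0) prod0.
by rewrite /dlsubmx !raddf0.
Qed.

End CreationOperators.

(** If the product vanished, the algebra morphism that the universal property
    attaches to the creation operators of the coordinate forms would make their
    product vanish too, contradicting [creation_top]. *)
Lemma wedge4_neq0 (F : fieldType) (V : vectType F) (A : falgType F)
    (iota : 'Hom(V, A)) (e0 e1 e2 e3 : V) :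
  exterior_algebra iota -> free [:: e0; e1; e2; e3] ->
  iota e0 * iota e1 * (iota e2 * iota e3) != 0.
Proof.
move=> [_ extA] free_e; pose e := [tuple e0; e1; e2; e3].
pose phi k : {scalar V} := coord e (inord k).
have phi_e i j : (i < 4)%N -> (j < 4)%N -> phi i e`_j = (i == j)%:R.
  move=> lti ltj; have := coord_free (X := e) (inord j) (inord i) free_e.
  by rewrite -val_eqE /= !inordK// eq_sym.
pose f : {linear V -> 'M[F]_(fock_dim 4)} := creation phi 4.
have [[g gE] _] := extA 'M[F]_16 f (creation_sq phi 4).
have := creation_top phi_e (leqnn 4).
rewrite !big_ord_recr big_ord0 /= mul1r -mulrA.
apply: contraNneq => e_0.
have := rmorph0 g; rewrite -e_0 !rmorphM /= !gE => fe_0; apply/eqP; exact: fe_0.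
Qed.

(** * Pluecker coordinates *)

Section Bivectors.

Variables (F : fieldType) (V : vectType F) (A : falgType F).
Variable iota : 'Hom(V, A).
Hypothesis iota_sq : forall v, iota v * iota v = 0.

Local Notation "u /\* v" := (iota u * iota v) (at level 40).

(** Polarization of the square-zero relation at [u + v]. *)
Lemma wedgeC u v : v /\* u = - (u /\* v).
Proof.
apply/eqP; rewrite -addr_eq0; apply/eqP.
have := iota_sq (u + v); rewrite linearD mulrDl !mulrDr !iota_sq add0r addr0.
by rewrite addrC.
Qed.

(** Grouped into one rewriting rule that removes from an expanded product of two
    bivectors all terms with a repeated vector. *)
Lemma wedge_shareE u v w :
  ((u /\* v) * (u /\* w) = 0) * ((u /\* v) * (w /\* u) = 0) *
  ((u /\* v) * (v /\* w) = 0) * ((u /\* v) * (w /\* v) = 0).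
Proof.
have vv x y z : (x /\* y) * (y /\* z) = 0.
  by rewrite mulrA -(mulrA (iota x)) iota_sq mulr0 mul0r.
have uw : (u /\* v) * (u /\* w) = 0 by rewrite (wedgeC v) mulNr vv oppr0.
have vw : (u /\* v) * (w /\* v) = 0 by rewrite (wedgeC v w) mulrN vv oppr0.
by do !split; rewrite ?vv// (wedgeC u w) mulrN uw oppr0.
Qed.

Definition bivector e0 e1 e2 e3 p01 p02 p03 p12 p13 p23 : A :=
  p01 *: (e0 /\* e1) + p02 *: (e0 /\* e2) + p03 *: (e0 /\* e3)
  + p12 *: (e1 /\* e2) + p13 *: (e1 /\* e3) + p23 *: (e2 /\* e3).

Lemma wedge2_comm u v w x : (u /\* v) * (w /\* x) = (w /\* x) * (u /\* v).
Proof.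
rewrite !mulrA -(mulrA (iota u)) (wedgeC w) mulrN mulNr mulrA (wedgeC w u).
rewrite !mulNr opprK -!mulrA (wedgeC x v) !mulrN (mulrA (iota u)) (wedgeC x u).
by rewrite mulNr mulrN opprK !mulrA.
Qed.

Lemma wedge_swap u v w x : (u /\* v) * (w /\* x) = - ((u /\* w) * (v /\* x)).
Proof. by rewrite !mulrA -(mulrA (iota u)) (wedgeC w) mulrN mulNr mulrA. Qed.

(** The form on the right is the polarization of the Pluecker quadratic form;
    on the diagonal it is twice that form. Of the 36 products of terms, only
    those of the six complementary pairs survive. *)
Lemma bivectorM e0 e1 e2 e3
    (p01 p02 p03 p12 p13 p23 q01 q02 q03 q12 q13 q23 : F) :
  bivector e0 e1 e2 e3 p01 p02 p03 p12 p13 p23 *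
  bivector e0 e1 e2 e3 q01 q02 q03 q12 q13 q23 =
  (p01 * q23 - p02 * q13 + p03 * q12 + p12 * q03 - p13 * q02 + p23 * q01)
    *: ((e0 /\* e1) * (e2 /\* e3)).
Proof.
have e0213 : (e0 /\* e2) * (e1 /\* e3) = - ((e0 /\* e1) * (e2 /\* e3)).
  exact: wedge_swap.
have e0312 : (e0 /\* e3) * (e1 /\* e2) = (e0 /\* e1) * (e2 /\* e3).
  by rewrite wedge_swap (wedgeC e2) mulrN opprK.
have e2301 := wedge2_comm e2 e3 e0 e1.
have e1302 := etrans (wedge2_comm e1 e3 e0 e2) e0213.
have e1203 := etrans (wedge2_comm e1 e2 e0 e3) e0312.
rewrite /bivector !mulrDl !mulrDr -!scalerAl -!scalerAr !scalerA.
rewrite !wedge_shareE e0213 e0312 e2301 e1302 e1203 !scaler0 !scalerN -!scaleNr.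
rewrite !addr0 !add0r -!scalerDl; congr (_ *: _); ring.
Qed.

(** Every one of the six coordinates can be brought into first position without
    changing the bivector, so that a nonzero coordinate may be assumed to be
    [p01]. *)
Lemma bivector_perm e0 e1 e2 e3 (p01 p02 p03 p12 p13 p23 : F) :
  let x := bivector e0 e1 e2 e3 p01 p02 p03 p12 p13 p23 in
  [/\ x = bivector e0 e2 e1 e3 p02 p01 p03 (- p12) p23 p13,
      x = bivector e0 e3 e1 e2 p03 p01 p02 (- p13) (- p23) p12,
      x = bivector e1 e2 e0 e3 p12 (- p01) p13 (- p02) p23 p03,
      x = bivector e1 e3 e0 e2 p13 (- p01) p12 (- p03) (- p23) p02 &
      x = bivector e2 e3 e0 e1 p23 (- p02) (- p12) (- p03) (- p13) p01].
Proof.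
rewrite /bivector (wedgeC e0 e1) (wedgeC e0 e2) (wedgeC e0 e3) (wedgeC e1 e2).
rewrite (wedgeC e1 e3) (wedgeC e2 e3) !scaleNr !scalerN !opprK.
split.
- by rewrite [LHS](AC 6 (2*1*3*4*6*5)%AC).
- by rewrite [LHS](AC 6 (3*1*2*5*6*4)%AC).
- by rewrite [LHS](AC 6 (4*1*5*2*6*3)%AC).
- by rewrite [LHS](AC 6 (5*1*4*3*6*2)%AC).
- by rewrite [LHS](AC 6 (6*2*4*3*5*1)%AC).
Qed.

Lemma bivector_decomposable_pivot e0 e1 e2 e3 (p01 p02 p03 p12 p13 p23 : F) :
    p01 != 0 -> p01 * p23 - p02 * p13 + p03 * p12 = 0 ->
  exists u v, bivector e0 e1 e2 e3 p01 p02 p03 p12 p13 p23 = u /\* v.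
Proof.
move=> p01_neq0 pf0.
have pfE : p01 * p23 = p02 * p13 - p03 * p12.
  by apply/eqP; rewrite -subr_eq0 -pf0 opprB addrA addrAC.
have p23E : p23 = p01^-1 * p13 * p02 - p01^-1 * p12 * p03.
  by rewrite -[LHS](mulKf p01_neq0) -!mulrA -mulrBr; congr (_ * _); ring: pfE.
(* Up to a scalar, this is the echelon basis with pivots e0, e1 of the
   two-dimensional subspace of V that the bivector represents; the quadratic
   relation makes the coordinate p23 match. *)
exists (e0 - (p01^-1 * p12) *: e2 - (p01^-1 * p13) *: e3).
exists (p01 *: e1 + p02 *: e2 + p03 *: e3).
rewrite /bivector !linearD !linearN !linearZ /= !mulrDl !mulrDr.
rewrite !scalerN !mulNr.
rewrite -!scalerAl -!scalerAr !scalerA !iota_sq.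
rewrite (wedgeC e1 e2) (wedgeC e1 e3) (wedgeC e2 e3) !scalerN !scaler0 !opprK.
have c01 q : p01^-1 * q * p01 = q by rewrite mulrAC mulVf// mul1r.
rewrite !oppr0 !addr0 !c01 [in LHS]p23E scalerBl.
by rewrite [RHS](AC (3*2*2)%AC (1*2*3*4*6*(7*5))%AC).
Qed.

Lemma bivector_decomposable e0 e1 e2 e3 (p01 p02 p03 p12 p13 p23 : F) :
    p01 * p23 - p02 * p13 + p03 * p12 = 0 ->
  exists u v, bivector e0 e1 e2 e3 p01 p02 p03 p12 p13 p23 = u /\* v.
Proof.
move=> pf0.
have pfE : p01 * p23 = p02 * p13 - p03 * p12.
  by apply/eqP; rewrite -subr_eq0 -pf0 opprB addrA addrAC.
have /= [E02 E03 E12 E13 E23] :=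
  bivector_perm e0 e1 e2 e3 p01 p02 p03 p12 p13 p23.
have [p01_0|p01_n0] := eqVneq p01 0; last exact: bivector_decomposable_pivot.
have [p02_0|p02_n0] := eqVneq p02 0; last first.
  by rewrite E02; apply: bivector_decomposable_pivot => //; ring: pfE.
have [p03_0|p03_n0] := eqVneq p03 0; last first.
  by rewrite E03; apply: bivector_decomposable_pivot => //; ring: pfE.
have [p12_0|p12_n0] := eqVneq p12 0; last first.
  by rewrite E12; apply: bivector_decomposable_pivot => //; ring: pfE.
have [p13_0|p13_n0] := eqVneq p13 0; last first.
  by rewrite E13; apply: bivector_decomposable_pivot => //; ring: pfE.
have [p23_0|p23_n0] := eqVneq p23 0; last first.
  by rewrite E23; apply: bivector_decomposable_pivot => //; ring: pfE.
exists 0, 0; rewrite /bivector p01_0 p02_0 p03_0 p12_0 p13_0 p23_0 linear0.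
by rewrite !scale0r mulr0 !addr0.
Qed.

End Bivectors.

(** * Bivectors in a basis of the vector space *)

Lemma free_pair_extend (F : fieldType) (V : vectType F) (u v : V) :
    \dim {:V} = 4%N -> free [:: u; v] ->
  exists e2 e3, basis_of fullv [:: u; v; e2; e3].
Proof.
move=> dimV free_uv; pose U := <<[:: u; v]>>%VS.
have dimU : \dim U = 2%N by apply/eqP.
have dimUC : \dim U^C = 2%N by rewrite dimv_compl dimV dimU.
have := size_tuple (vbasis U^C).
case E: (val (vbasis U^C)) => [|e2 [|e3 [|? ?]]] /=; rewrite dimUC // => _.
exists e2, e3; rewrite basisEfree subvf dimV /= andbT.
have -> : [:: u; v; e2; e3] = [:: u; v] ++ vbasis U^C by rewrite E.
rewrite cat_free free_uv (basis_free (vbasisP _)) (span_basis (vbasisP _)).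
by apply/directv_addP; rewrite capv_compl.
Qed.

Lemma pair_free (F : fieldType) (V : vectType F) (A : falgType F)
    (iota : 'Hom(V, A)) (u v : V) :
  (forall w, iota w * iota w = 0) -> iota u * iota v != 0 -> free [:: u; v].
Proof.
move=> iota_sq uv_neq0; rewrite free_cons span_seq1 seq1_free.
apply/andP; split.
  apply: contra uv_neq0 => /vlineP[k ->].
  by rewrite linearZ -scalerAl iota_sq scaler0.
by apply: contraNneq uv_neq0 => ->; rewrite linear0 mulr0.
Qed.

Lemma memv_wedge (F : fieldType) (V : vectType F) (A : falgType F)
    (iota : 'Hom(V, A)) u v :
  iota u * iota v \in wedge2 iota.
Proof. by rewrite memv_mul// memv_img ?memvf. Qed.

Lemma memv_bivector (F : fieldType) (V : vectType F) (A : falgType F)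
    (iota : 'Hom(V, A)) e0 e1 e2 e3 (p01 p02 p03 p12 p13 p23 : F) :
  bivector iota e0 e1 e2 e3 p01 p02 p03 p12 p13 p23 \in wedge2 iota.
Proof. by rewrite !memvD// memvZ// memv_wedge. Qed.

Section Basis.

Variables (F : fieldType) (V : vectType F) (A : falgType F).
Variable iota : 'Hom(V, A).
Hypothesis extA : exterior_algebra iota.
Variables e0 e1 e2 e3 : V.
Hypothesis basis_e : basis_of fullv [:: e0; e1; e2; e3].

Local Notation "u /\* v" := (iota u * iota v) (at level 40).
Local Notation bivec := (bivector iota e0 e1 e2 e3).
Local Notation pairs := [:: e0 /\* e1; e0 /\* e2; e0 /\* e3;
                            e1 /\* e2; e1 /\* e3; e2 /\* e3].

Let iota_sq : forall v, iota v * iota v = 0. Proof. by have [] := extA. Qed.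

Let vol_neq0 : (e0 /\* e1) * (e2 /\* e3) != 0.
Proof. exact: wedge4_neq0 (basis_free basis_e). Qed.

(** Pairing with the complementary basis bivector reads off each coordinate, so
    the form is nondegenerate and the six basis bivectors are independent. *)
Lemma bivector_eq0 p01 p02 p03 p12 p13 p23 :
    (forall q01 q02 q03 q12 q13 q23,
      bivec p01 p02 p03 p12 p13 p23 * bivec q01 q02 q03 q12 q13 q23 = 0) ->
  [/\ p01 = 0, p02 = 0, p03 = 0, p12 = 0 & p13 = 0 /\ p23 = 0].
Proof.
move=> x_orth.
have pair0 q01 q02 q03 q12 q13 q23 :
    p01 * q23 - p02 * q13 + p03 * q12 + p12 * q03 - p13 * q02 + p23 * q01 = 0.
  apply/eqP; have /eqP := x_orth q01 q02 q03 q12 q13 q23.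
  by rewrite bivectorM// scaler_eq0 (negPf vol_neq0) orbF.
split; last split.
- by rewrite -(pair0 0 0 0 0 0 1); ring.
- by rewrite -(pair0 0 0 0 0 (-1) 0); ring.
- by rewrite -(pair0 0 0 0 1 0 0); ring.
- by rewrite -(pair0 0 0 1 0 0 0); ring.
- by rewrite -(pair0 0 (-1) 0 0 0 0); ring.
- by rewrite -(pair0 1 0 0 0 0 0); ring.
Qed.

Lemma free_pairs : free pairs.
Proof.
apply/(freeP (X := [tuple of pairs])) => k; rewrite !big_ord_recl big_ord0 /=.
rewrite addr0 !addrA => bivec0.
have orth q01 q02 q03 q12 q13 q23 := etrans
  (congr1 (fun x => x * bivec q01 q02 q03 q12 q13 q23) bivec0) (mul0r _).
have [k0 k1 k2 k3 [k4 k5]] := bivector_eq0 orth.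
by case=> [[|[|[|[|[|[|//]]]]]] lti];
  [rewrite -[RHS]k0|rewrite -[RHS]k1|rewrite -[RHS]k2|rewrite -[RHS]k3
  |rewrite -[RHS]k4|rewrite -[RHS]k5]; congr k; apply: val_inj.
Qed.

Lemma wedge2_span : wedge2 iota = <<pairs>>%VS.
Proof.
apply/eqP; rewrite eqEsubv; apply/andP; split; last first.
  apply/span_subvP => x; rewrite !inE.
  by do ?[case/predU1P=> [->|]|move/eqP->]; rewrite memv_wedge.
have basis_wedge i j : (i < 4)%N -> (j < 4)%N ->
    iota [:: e0; e1; e2; e3]`_i * iota [:: e0; e1; e2; e3]`_j \in <<pairs>>%VS.
  wlog leij : i j / (i <= j)%N => [IH|] lti ltj.
    case: (leqP i j) => [|/ltnW] leij; first exact: IH.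
    by rewrite wedgeC// memvN IH.
  by case: i j lti ltj leij => [|[|[|[|]]]] [|[|[|[|]]]] //= _ _ _;
    rewrite ?iota_sq ?mem0v// memv_span// !inE eqxx ?orbT.
apply/prodvP => _ _ /memv_imgP[u _ ->] /memv_imgP[v _ ->].
have coordE w :
    w = \sum_i coord [tuple e0; e1; e2; e3] i w *: [:: e0; e1; e2; e3]`_i.
  apply: (coord_span (X := [tuple e0; e1; e2; e3])).
  by rewrite (span_basis basis_e) memvf.
rewrite (coordE u) (coordE v) !linear_sum /= mulr_suml; apply: memv_suml => i _.
rewrite mulr_sumr; apply: memv_suml => j _.
by rewrite !linearZ /= -scalerAl -scalerAr !memvZ// basis_wedge.
Qed.

Lemma wedge2P x :
  reflect (exists p01 p02 p03 p12 p13 p23, x = bivec p01 p02 p03 p12 p13 p23)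
          (x \in wedge2 iota).
Proof.
apply: (iffP idP) => [|[? [? [? [? [? [? ->]]]]]]]; last exact: memv_bivector.
rewrite wedge2_span => xP.
have := coord_span (X := [tuple of pairs]) xP.
rewrite !big_ord_recl big_ord0 addr0 /= !addrA => ->.
by do 6!eexists.
Qed.

Lemma dim_wedge2 : \dim (wedge2 iota) = 6%N.
Proof. by rewrite wedge2_span; apply/eqP; apply: free_pairs. Qed.

End Basis.

(** * The wedge form on bivectors and its polarity *)

Section WedgeForm.

Variables (F : fieldType) (V : vectType F) (A : falgType F).
Variable iota : 'Hom(V, A).
Hypothesis extA : exterior_algebra iota.
Hypothesis dimV : \dim {:V} = 4%N.

Local Notation W := (wedge2 iota).

Let iota_sq : forall v, iota v * iota v = 0. Proof. by have [] := extA. Qed.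

Let ex_basis : exists e0 e1 e2 e3 : V, basis_of fullv [:: e0; e1; e2; e3].
Proof.
have := vbasisP {:V}; have := size_tuple (vbasis {:V}); move: (tval _).
by rewrite dimV => -[|e0 [|e1 [|e2 [|e3 [|? ?]]]]] // _ basis_e;
  exists e0, e1, e2, e3.
Qed.

Lemma wedge2M_line : exists t, {in W &, forall x y, x * y \in <[t]>%VS}.
Proof.
have [e0 [e1 [e2 [e3 be]]]] := ex_basis.
exists ((iota e0 * iota e1) * (iota e2 * iota e3)) => x y.
move=> /(wedge2P extA be)[? [? [? [? [? [? ->]]]]]].
move=> /(wedge2P extA be)[? [? [? [? [? [? ->]]]]]].
by rewrite bivectorM// memvZ// memv_line.
Qed.

Lemma wedge2_mulC : {in W &, commutative *%R}.
Proof.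
have [e0 [e1 [e2 [e3 be]]]] := ex_basis => x y.
move=> /(wedge2P extA be)[? [? [? [? [? [? ->]]]]]].
move=> /(wedge2P extA be)[? [? [? [? [? [? ->]]]]]].
by rewrite !bivectorM//; congr (_ *: _); ring.
Qed.

Lemma wedge2_nondegenerate x :
  x \in W -> {in W, forall y, x * y = 0} -> x = 0.
Proof.
have [e0 [e1 [e2 [e3 be]]]] := ex_basis.
move=> /(wedge2P extA be)[p01 [p02 [p03 [p12 [p13 [p23 ->]]]]]] orth.
have x_orth q01 q02 q03 q12 q13 q23 :=
  orth _ (memv_bivector iota e0 e1 e2 e3 q01 q02 q03 q12 q13 q23).
have [-> -> -> -> [-> ->]] := bivector_eq0 extA be x_orth.
by rewrite /bivector !scale0r !addr0.
Qed.

Lemma wedge2_sq_char2 x : 2%N \in [pchar F] -> x \in W -> x * x = 0.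
Proof.
have [e0 [e1 [e2 [e3 be]]]] := ex_basis.
move=> char2 /(wedge2P extA be)[p01 [p02 [p03 [p12 [p13 [p23 ->]]]]]].
rewrite bivectorM//.
rewrite [X in X *: _](_ : _ = 2%:R * (p01 * p23 - p02 * p13 + p03 * p12)).
  by rewrite (pcharf0 char2) mul0r scale0r.
by ring.
Qed.

(** The square is twice the Pluecker form, so this is the point where the
    characteristic matters: in characteristic 2 every square vanishes. *)
Lemma wedge2_sq0_decomposable x : 2%N \notin [pchar F] ->
  x \in W -> x * x = 0 -> exists u v, x = iota u * iota v.
Proof.
have [e0 [e1 [e2 [e3 be]]]] := ex_basis.
move=> char2 /(wedge2P extA be)[p01 [p02 [p03 [p12 [p13 [p23 ->]]]]]] /eqP.
rewrite bivectorM// scaler_eq0 (negPf (wedge4_neq0 extA (basis_free be))) orbF.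
move=> pf0; apply: bivector_decomposable => //; apply/eqP; move: pf0.
rewrite [X in X == 0](_ : _ = 2%:R * (p01 * p23 - p02 * p13 + p03 * p12)).
  by move: char2; rewrite mulf_eq0 inE /= => /negbTE->.
by ring.
Qed.

Lemma polar_sub X : (polar iota X <= W)%VS.
Proof. exact: capvSl. Qed.

(** Orthogonality to [Y] imposes at most [\dim Y] linear conditions, because the
    form takes its values in a line. *)
Lemma dim_cap_polar (U Y : {vspace A}) : (U <= W)%VS -> (Y <= W)%VS ->
  (\dim U <= \dim (U :&: polar iota Y) + \dim Y)%N.
Proof.
have [t tP] := wedge2M_line => UW YW.
suff seq_bound (s : seq A) : {subset s <= W} ->
    (\dim U <= \dim (U :&: \bigcap_(x <- s) lker (amull x)) + size s)%N.
  rewrite capvA (capv_idPl UW) -{2}(size_tuple (vbasis Y)).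
  by apply: seq_bound => x /vbasis_mem/(subvP YW).
elim: s => [_|x s IHs sW]; first by rewrite big_nil capvf addn0.
rewrite big_cons [(lker _ :&: _)%VS]capvC capvA.
set K := (U :&: \bigcap_(x <- s) _)%VS.
have := limg_ker_dim (amull x) K.
have im1 : (\dim (amull x @: K) <= 1)%N.
  apply: (leq_trans (n := \dim <[t]>)); last by rewrite dim_vline leq_b1.
  apply: dimvS.
  apply/subvP => _ /memv_imgP[y /memv_capP[yU _] ->].
  by rewrite lfunE /= tP//; [apply: sW; apply: mem_head|apply: subvP yU].
have IH : (\dim U <= \dim K + size s)%N.
  by apply: IHs => y ys; rewrite sW// in_cons ys orbT.
by rewrite /=; lia.
Qed.

(** The inequality [dim_cap_polar] for [X] gives one bound. The other one is the
    same inequality for a complement of [X]: the polars of [X] and of its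
    complement meet in the radical, which is zero. *)
Lemma dim_polar (X : {vspace A}) : (X <= W)%VS ->
  (\dim (polar iota X) + \dim X)%N = 6%N.
Proof.
move=> XW; have [e0 [e1 [e2 [e3 be]]]] := ex_basis.
have dimW := dim_wedge2 extA be.
have := dim_cap_polar (subvv W) XW.
rewrite (capv_idPr (polar_sub X)) dimW => ge6.
have YW : (W :\: X <= W)%VS by rewrite diffvSl.
have := dim_cap_polar (polar_sub X) YW.
have -> : (polar iota X :&: polar iota (W :\: X))%VS = 0%VS.
  apply/eqP; rewrite -subv0; apply/subvP => y /memv_capP[yX yY].
  rewrite memv0; apply/eqP/wedge2_nondegenerate.
    exact: subvP (polar_sub X) _ yX.
  move=> x xW; rewrite wedge2_mulC//; last exact: subvP (polar_sub X) _ yX.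
  have := addv_diff_cap W X; rewrite (capv_idPr XW) => WE.
  have : x \in (W :\: X + X)%VS by rewrite WE.
  case/memv_addP => x1 x1Y [x2 x2X ->].
  case/polarP: yX => _ yX; case/polarP: yY => _ yY.
  by rewrite mulrDl (yX x2)// (yY x1)// addr0.
have := dimv_cap_compl W X; rewrite (capv_idPr XW) dimW dimv0.
by lia.
Qed.

End WedgeForm.

(** * Planes without points on the quadric *)

Section Planes.

Variables (F : fieldType) (V : vectType F) (A : falgType F).
Variable iota : 'Hom(V, A).
Hypothesis extA : exterior_algebra iota.
Hypothesis dimV : \dim {:V} = 4%N.

Local Notation W := (wedge2 iota).

Let iota_sq : forall v, iota v * iota v = 0. Proof. by have [] := extA. Qed.

Lemma disjoint_wedge_eq0 (C : {vspace A}) u v :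
    disjoint_from_quadric iota C -> iota u * iota v \in C ->
  iota u * iota v = 0.
Proof.
move=> C_Q uvC; apply: contraPeq (C_Q <[iota u * iota v]>%VS) => uv0 C_P.
apply: C_P; rewrite /is_point ?dim_vline ?uv0 -?memvE ?memv_wedge//.
by exists u, v; split=> //; apply: pair_free uv0.
Qed.

(** If [s = u /\ v] were in the polar, then [C] and the plane of all [u /\ w]
    would both lie in the five-dimensional polar of [s], so they would share a
    nonzero bivector, and it would be decomposable. *)
Lemma polar_disjoint (C : {vspace A}) :
    (C <= W)%VS -> \dim C = 3%N -> disjoint_from_quadric iota C ->
  disjoint_from_quadric iota (polar iota C).
Proof.
move=> CW dimC C_Q P [_ dimP] + [u [v [free_uv defP]]].
rewrite {P}defP in dimP *; set s := iota u * iota v in dimP *.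
rewrite -memvE => /polarP[sW sC].
have [e2 [e3 be]] := free_pair_extend dimV free_uv.
pose uV := [:: s; iota u * iota e2; iota u * iota e3]; pose N := <<uV>>%VS.
have dimN : \dim N = 3%N.
  by apply/eqP; exact: (@catl_free _ _ _ uV (free_pairs extA be)).
have NE n : n \in N -> exists w, n = iota u * iota w.
  move=> /(coord_span (X := [tuple _; _; _])).
  rewrite !big_ord_recl big_ord0 addr0 /= !scalerAr.
  rewrite -!linearZ -!mulrDr -!linearD.
  by move=> ->; eexists.
pose T := polar iota <[s]>.
have memT y : y \in W -> s * y = 0 -> y \in T.
  move=> yW sy; apply/polarP; split=> // _ /vlineP[k ->].
  by rewrite -scalerAl sy scaler0.
have CT : (C <= T)%VS.
  apply/subvP => c cC; have cW := subvP CW _ cC.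
  by apply: memT => //; rewrite (wedge2_mulC extA dimV)// sC.
have NT : (N <= T)%VS.
  apply/subvP => _ /NE[w ->]; apply: memT; first exact: memv_wedge.
  by rewrite wedge_shareE.
have dimT : (\dim T + 1)%N = 6%N.
  by rewrite -(dim_polar extA dimV (X := <[s]>)) ?dimP -?memvE.
have CN_le : (\dim (C + N) <= \dim T)%N by rewrite dimvS// subv_add CT.
have CN0 : (C :&: N)%VS != 0%VS.
  have := dimv_sum_cap C N; rewrite dimC dimN -dimv_eq0 -lt0n; lia.
have /memv_capP[nC nN] := memv_pick (C :&: N)%VS.
have [w defn] := NE _ nN; move: CN0; rewrite -vpick0 defn => /eqP; apply.
by apply: disjoint_wedge_eq0 C_Q _; rewrite -defn.
Qed.

(** A common point is isotropic, hence decomposable when 2 is invertible. *)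
Lemma no_common_point_polar (C : {vspace A}) :
    2%N \notin [pchar F] -> disjoint_from_quadric iota C ->
  no_common_point iota C (polar iota C).
Proof.
move=> char2 C_Q P [PW dimP] [PC PCp].
have xP := memv_pick P.
have : vpick P != 0 by rewrite vpick0 -dimv_eq0 dimP.
have /polarP[xW /(_ _ (subvP PC _ xP)) xx] := subvP PCp _ xP.
have [u [v defx]] := wedge2_sq0_decomposable extA dimV char2 xW xx.
by rewrite defx (disjoint_wedge_eq0 C_Q) ?eqxx// -defx (subvP PC).
Qed.

(** If [C] is not totally isotropic, it contains a hyperbolic pair [x], [y]. The
    span [L] of the pair is nondegenerate, so [C] is the direct sum of [L] and
    the orthogonal [T] of [L] in [C]. As [T] is a line and the form is
    alternating, [T] is the radical. *)
Lemma cap_polar_alternating (C : {vspace A}) :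
    2%N \in [pchar F] -> (C <= W)%VS -> \dim C = 3%N ->
  is_point iota (C :&: polar iota C)%VS \/ C = polar iota C.
Proof.
move=> char2 CW dimC.
have [CCp|nCCp] := boolP (C <= polar iota C)%VS.
  right; apply/eqP; rewrite -(dimv_leqif_eq CCp) dimC.
  by have := dim_polar extA dimV CW; lia.
left.
have sq0 z : z \in C -> z * z = 0.
  by move/(subvP CW)/(wedge2_sq_char2 extA dimV char2).
have mulC : {in C &, commutative *%R}.
  by move=> y z /(subvP CW) yW /(subvP CW); apply: wedge2_mulC.
have [x xC nxCp] := subvPn nCCp.
have [y yC yx0] : exists2 y, y \in C & y * x != 0.
  have : ~~ (C <= lker (amulr x))%VS.
    apply: contra nxCp => /subvP xCker; apply/polarP; split.
      exact: subvP CW _ xC.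
    by move=> y /xCker; rewrite memv_ker lfunE => /eqP.
  by move/subvPn => [y yC]; rewrite memv_ker lfunE; exists y.
pose L := <<[:: x; y]>>%VS.
have LC : (L <= C)%VS by apply/span_subvP => z; rewrite !inE => /orP[]/eqP->.
have dimL : (\dim L <= 2)%N by apply: dim_span.
pose T := (C :&: polar iota L)%VS.
have dimT : (\dim C <= \dim T + \dim L)%N.
  exact: (dim_cap_polar extA dimV CW (subv_trans LC CW)).
have LE z : z \in L -> exists a b, z = a *: x + b *: y.
  move=> /(coord_span (X := [tuple _; _])).
  by rewrite !big_ord_recl big_ord0 addr0 /= => ->; do 2!eexists.
have LT0 : (L :&: T)%VS = 0%VS.
  apply/eqP; rewrite -subv0; apply/subvP => z /memv_capP[].
  move=> /LE[a [b ->]] /memv_capP[_ /polarP[_ orth]]; rewrite memv0.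
  have := orth x; have := orth y.
  have -> : x \in L by apply: memv_span; rewrite !inE eqxx.
  have -> : y \in L by apply: memv_span; rewrite !inE eqxx orbT.
  rewrite !mulrDr -!scalerAr !sq0// (mulC x y)// !scaler0 addr0 add0r.
  move=> /(_ isT)/eqP + /(_ isT)/eqP.
  rewrite !scaler_eq0 (negPf yx0) !orbF => /eqP-> /eqP->.
  by rewrite !scale0r addr0.
have dimLT := dimv_sum_cap L T; rewrite LT0 dimv0 addn0 in dimLT.
have LTC : (L + T <= C)%VS by rewrite subv_add LC capvSl.
have dimL2 : \dim L = 2%N.
  apply/eqP; rewrite -/(free _) free_cons span_seq1 seq1_free.
  apply/andP; split; last by apply: contraNneq yx0 => ->; rewrite mul0r.
  by apply: contra yx0 => /vlineP[k ->]; rewrite -scalerAr sq0// scaler0.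
have dimT1 : \dim T = 1%N by have := dimvS LTC; lia.
have defC : (L + T)%VS = C.
  by apply/eqP; rewrite -(dimv_leqif_eq LTC) dimLT dimC dimL2 dimT1.
suff -> : (C :&: polar iota C)%VS = T.
  by split=> //; apply: subv_trans CW; apply: capvSl.
apply/eqP; rewrite eqEsubv; apply/andP; split; apply/subvP => z.
  case/memv_capP => zC /polarP[zW orth]; rewrite memv_cap zC.
  by apply/polarP; split=> // w /(subvP LC); apply: orth.
move=> zT; have /memv_capP[zC /polarP[zW orthL]] := zT.
rewrite memv_cap zC; apply/polarP; split=> // c.
rewrite -defC => /memv_addP[w wL [t tT ->]]; rewrite mulrDl orthL// add0r.
have defT : <[vpick T]>%VS = T.
  apply/eqP; rewrite eqEdim -memvE memv_pick dimT1 dim_vline vpick0.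
  by rewrite -dimv_eq0 dimT1.
move: zT tT; rewrite -defT => /vlineP[k ->] /vlineP[l ->].
by rewrite -scalerAl -scalerAr sq0 ?scaler0//; have /memv_capP[] := memv_pick T.
Qed.

End Planes.

Theorem proposition4p6 (F : fieldType) (V : vectType F)
    (dimV : \dim {:V} = 4%N)
    (A : falgType F) (iota : 'Hom(V, A)) (extA : exterior_algebra iota)
    (C : {vspace A}) (planeC : is_plane iota C)
    (C_Q : disjoint_from_quadric iota C) :
  (is_plane iota (polar iota C) /\ disjoint_from_quadric iota (polar iota C)) /\
  (2%N \notin [pchar F] -> no_common_point iota C (polar iota C)) /\
  (2%N \in [pchar F] ->
     is_point iota (C :&: polar iota C)%VS \/ C = polar iota C).
Proof.
have [CW dimC] := planeC; split; [split; first split|split].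
- exact: polar_sub.
- by have := dim_polar extA dimV CW; lia.
- exact: polar_disjoint.
- by move=> char2; apply: no_common_point_polar.
- by move=> char2; apply: cap_polar_alternating.
Qed.
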